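(* Let $G$ be a finite alphabet, let $\mathfrak{G}\subseteq G^{\mathbb{Z}}$ be a topological Markov chain using all letters of $G$, and let $(\mathfrak{G},\Phi)$ be a structurally compatible bipermutative cellular automaton. Then there exist a shift space $\mathfrak{H}=\mathbb{F}\times\Sigma_n$, where $\mathbb{F}$ is finite and $\Sigma_n$ is a full $n$-shift, an integer $k\ge 1$ and a $k$-block quasi-group operation $\otimes$ on $\mathfrak{H}$ such that, with $\Phi_{\mathfrak{H}}:=\mathrm{id}_{\mathfrak{H}}\otimes\sigma_{\mathfrak{H}}$ (that is, $\Phi_{\mathfrak{H}}(\mathbf{x})=\mathbf{x}\otimes\sigma_{\mathfrak{H}}(\mathbf{x})$): (i) $(\mathfrak{G},\Phi)$ is topologically conjugate to $(\mathfrak{H},\Phi_{\mathfrak{H}})$ through a $1$-block code; (ii) the topological entropy $\mathbf{h}(\mathfrak{G})$ of the shift on $\mathfrak{G}$ is $0$ if and only if $\Sigma_n=\{(\ldots,a,a,a,\ldots)\}$ (that is, the full shift $\Sigma_n$ is trivial); (iii) $\mathfrak{G}$ is irreducible and contains a constant sequence if and only if $\mathbb{F}$ consists of a single element.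
   Context: For a finite alphabet $G$, $\sigma$ is the shift map, $(\sigma(\mathbf{g}))_n=g_{n+1}$ (with a subscript to indicate the shift space). A subshift $\mathfrak{G}\subseteq G^{\mathbb{Z}}$ is a topological Markov chain if for every allowed word $(g_1,\dots,g_k)$ the set of letters that may follow it depends only on $g_k$. It is irreducible if for all letters $u,w$ there is $k\ge1$ and a word $(v_1,\dots,v_k)$ such that $(u,v_1,\dots,v_k,w)$ is allowed in $\mathfrak{G}$. A map $\Theta:\Lambda\to\Lambda'$ between shift spaces is an $(\ell+r+1)$-block code (memory $\ell$, anticipation $r$) if there is a local rule $\theta$ with $(\Theta(\mathbf{x}))_j=\theta(x_{j-\ell},\ldots,x_{j+r})$ for all $\mathbf{x},j$. A binary operation on a shift space $\mathfrak{H}$ is $k$-block if, as a map $\mathfrak{H}\times\mathfrak{H}\to\mathfrak{H}$, it is a $k$-block code. A quasi-group operation is a binary operation all of whose left and right translations are bijective. A cellular automaton $(\mathfrak{G},\Phi)$ with radio $1$ is given by a map $\phi:G\times G\to G$ (the local rule) such that $\Phi(\mathbf{x})=(\phi(x_i,x_{i+1}))_{i\in\mathbb{Z}}$ maps $\mathfrak{G}$ into $\mathfrak{G}$. It is structurally compatible if $(x_i)_{i\in\mathbb{Z}},(y_i)_{i\in\mathbb{Z}}\in\mathfrak{G}$ implies $(\phi(x_i,y_i))_{i\in\mathbb{Z}}\in\mathfrak{G}$. It is right permutative if $g\mapsto\phi(w,g)$ is a permutation of $G$ for each $w\in G$, left permutative if $g\mapsto\phi(g,w)$ is a permutation of $G$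 for each $w\in G$, and bipermutative if it is both. $\mathbb{F}$ is a shift space with finitely many points. Two systems $(X,\Phi)$, $(Y,\Psi)$ are topologically conjugate through a $1$-block code if there is a homeomorphism $\varphi:X\to Y$ which is a $1$-block code and satisfies $\varphi\circ\Phi=\Psi\circ\varphi$. *)

(* Defs.v *)
From HB Require Import structures.
From mathcomp Require Import all_boot all_order all_algebra.
From mathcomp Require Import finmap.
From mathcomp Require Import all_classical all_reals all_analysis.

Set Implicit Arguments.
Unset Strict Implicit.
Unset Printing Implicit Defensive.

Import Order.TTheory GRing.Theory Num.Theory numFieldNormedType.Exports.

Local Open Scope classical_set_scope.
Local Open Scope ring_scope.

(* A^Z with the product of the discrete topologies.  Dynamical systems are
   given by an invariant set X of such a space and a map of the whole space,
   of which only the restriction to X matters. *)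
Definition config (A : finType) : topologicalType :=
  prod_topology (fun _ : int => discrete_topology A).

Definition constant_config (A : finType) (a : A) : config A := fun _ => a.

Definition shift_map (A : finType) (x : config A) : config A := fun i => x (i + 1).

Definition subshift (A : finType) (X : set (config A)) : Prop :=
  closed X /\ @shift_map A @` X = X.

Definition full_shift (A : finType) : set (config A) := setT.
Arguments full_shift : clear implicits.

(* X x Y, as a shift space over the product alphabet. *)
Definition fst_config (A B : finType) (z : config (A * B)%type) : config A :=
  fun i => (z i : A * B).1.

Definition snd_config (A B : finType) (z : config (A * B)%type) : config B :=
  fun i => (z i : A * B).2.

Definition prod_shift (A B : finType) (X : set (config A)) (Y : set (config B))
    : set (config (A * B)%type) :=
  [set z | X (fst_config z) /\ Y (snd_config z)].

Definition allowed (A : finType) (X : set (config A)) (w : seq A) : Prop :=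
  exists2 x : config A, X x &
    exists i : int, w = [seq (x (i + j%:Z) : A) | j <- iota 0 (size w)].

Definition uses_all_letters (A : finType) (X : set (config A)) : Prop :=
  forall a : A, allowed X [:: a].

Definition followers (A : finType) (X : set (config A)) (w : seq A) : set A :=
  [set b | allowed X (rcons w b)].

Definition topological_Markov_chain (A : finType) (X : set (config A)) : Prop :=
  subshift X /\
  forall (u v : seq A) (a : A),
    allowed X (rcons u a) -> allowed X (rcons v a) ->
    followers X (rcons u a) = followers X (rcons v a).

Definition irreducible_shift (A : finType) (X : set (config A)) : Prop :=
  forall u w : A, exists2 v : seq A, (0 < size v)%N & allowed X (u :: rcons v w).

Definition block_code_mem (A B : finType) (l r : nat) (X : set (config A))
    (f : config A -> config B) : Prop :=
  exists theta : (l + r).+1.-tuple A -> B, forall x, X x -> forall j : int,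
    f x j = theta [tuple (x (j - l%:Z + (i : nat)%:Z) : A) | i < (l + r).+1].

Definition block_code (A B : finType) (k : nat) (X : set (config A))
    (f : config A -> config B) : Prop :=
  exists l r : nat, k = (l + r).+1 /\ block_code_mem l r X f.

Definition block_operation (A : finType) (k : nat) (X : set (config A))
    (op : config A -> config A -> config A) : Prop :=
  block_code k (prod_shift X X) (fun z => op (fst_config z) (snd_config z)).

Definition quasigroup_operation (A : finType) (X : set (config A))
    (op : config A -> config A -> config A) : Prop :=
  forall x, X x -> set_bij X X (fun y => op x y) /\
                   set_bij X X (fun y => op y x).

Definition ca_map (G : finType) (phi : G -> G -> G) (x : config G) : config G :=
  fun i => phi (x i) (x (i + 1)).

Definition cellular_automaton (G : finType) (X : set (config G))
    (phi : G -> G -> G) : Prop :=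
  forall x, X x -> X (ca_map phi x).

Definition structurally_compatible (G : finType) (X : set (config G))
    (phi : G -> G -> G) : Prop :=
  forall x y, X x -> X y -> X (fun i => phi (x i) (y i)).

Definition right_permutative (G : finType) (phi : G -> G -> G) : Prop :=
  forall w, bijective (fun g => phi w g).

Definition left_permutative (G : finType) (phi : G -> G -> G) : Prop :=
  forall w, bijective (fun g => phi g w).

Definition bipermutative (G : finType) (phi : G -> G -> G) : Prop :=
  right_permutative phi /\ left_permutative phi.

Definition homeomorphism (S T : topologicalType) (X : set S) (Y : set T)
    (f : S -> T) : Prop :=
  exists g : T -> S,
    [/\ (forall x, X x -> Y (f x) /\ g (f x) = x),
        (forall y, Y y -> X (g y) /\ f (g y) = y),
        {within X, continuous f} & {within Y, continuous g}].

Definition conjugate_through_block_code (A B : finType) (k : nat)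
    (X : set (config A)) (F : config A -> config A)
    (Y : set (config B)) (H : config B -> config B) : Prop :=
  exists f : config A -> config B,
    [/\ homeomorphism X Y f, block_code k X f &
        forall x, X x -> f (F x) = H (f x)].

(* Topological entropy of f restricted to an invariant compact set X, in the
   sense of Adler, Konheim and McAndrew.  Relatively open sets of X are
   represented by open sets of T, so a cover of X need not cover T. *)
Definition open_cover (T : topologicalType) (X : set T) (U : set (set T))
    : Prop :=
  (forall u, U u -> open u) /\ X `<=` \bigcup_(u in U) u.

Definition cover_number (R : realType) (T : topologicalType) (X : set T)
    (U : set (set T)) : R :=
  inf [set (#|` D|)%:R | D in [set D : {fset (set T)} |
    [set` D] `<=` U /\ X `<=` \bigcup_(u in [set` D]) u]].

Definition cover_join (T : Type) (U V : set (set T)) : set (set T) :=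
  [set w | exists2 u, U u & exists2 v, V v & w = u `&` v].

(* U \/ f^-1 U \/ ... \/ f^-(n-1) U *)
Fixpoint iterated_join (T : Type) (f : T -> T) (U : set (set T)) (n : nat)
    : set (set T) :=
  if n is m.+1 then
    cover_join (iterated_join f U m) [set iter m f @^-1` u | u in U]
  else [set setT].

Definition cover_entropy (R : realType) (T : topologicalType) (X : set T)
    (f : T -> T) (U : set (set T)) : R :=
  limn (fun n => ln (cover_number R X (iterated_join f U n)) / n%:R).

Definition topological_entropy (R : realType) (T : topologicalType) (X : set T)
    (f : T -> T) : \bar R :=
  ereal_sup [set (cover_entropy R X f U)%:E | U in open_cover X].

(* Main.v *)
Require Import Defs.
From HB Require Import structures.
From mathcomp Require Import all_boot all_order all_algebra.
From mathcomp Require Import finmap.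
From mathcomp Require Import all_classical all_reals all_analysis.
From mathcomp Require Import zify ring.

(** Write [E a b] when the word [ab] occurs in the chain [X].  The Markov
    property makes [X] the set of bi-infinite walks of [E]
    ([Markov_chain_walks]), and structural compatibility says that [E] is a
    subquasigroup of [G * G] for the operation [phi] ([successor_mul]).  The
    statement then becomes one about a finite quasigroup with a compatible
    relation.

    In such a quasigroup all translations are injective and map follower sets
    into follower sets, so all follower sets have the same size [n], and two of
    them are equal or disjoint ([card_followers], [common_follower]).  The
    follower sets therefore form a quotient quasigroup [V], and sending a letter
    [a] to the follower set [s a] that contains it and to its own follower set
    [t a] presents [E] as the edge relation of a graph with edges [G] and
    vertices [V]: [E a b] holds when [t a = s b] ([edge_presentation]).

    If [V] has as many elements as [G], then [s] and [t] are bijections, [E] is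
    the graph of the permutation [s^-1 \o t], and [X] is the finite set of its
    orbits.  Otherwise all nonempty classes of parallel edges have the same size
    [k], because [(s, t)] is a homomorphism ([card_fiber]).  Numbering the edges
    of each class, a walk of edges is the same thing as the walk of vertices
    that it visits together with an arbitrary sequence of numbers below [k]: the
    visited vertices are a 1-block image of the walk, and one step of
    anticipation suffices to recover it.  So [X] is a walk space over the
    smaller quasigroup [V] times a full [k]-shift ([extend_splitting]), and
    induction on the size of [G] gives a 1-block conjugacy of [X] with
    (orbits of a permutation) x (full [n]-shift), where the inverse has some
    anticipation [r] ([markov_splitting]).  The operation on the product is
    [phi], transported through this conjugacy.

    For the entropy: by uniformity of the follower sets the cover of [X] by the
    letters has exactly [#|G| * n ^ l] nonempty cells after [l.+1] steps, so its
    entropy is [ln n] ([entropy_positive] for [n > 1]); if [n = 1] then [X] is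
    finite and has entropy [0] ([entropy_finite]).  For irreducibility: an orbit
    of the permutation is determined by any one of its letters, so walking from
    a constant point of an irreducible [X] to any other point shows that there
    is only one orbit; conversely, in a full shift any two half-sequences can be
    glued ([irreducible_constant_orbits]). *)

Set Implicit Arguments.
Unset Strict Implicit.
Unset Printing Implicit Defensive.

Import Order.TTheory GRing.Theory Num.Theory numFieldNormedType.Exports.

Local Open Scope classical_set_scope.
Local Open Scope ring_scope.

(** * Finite quasigroups with a compatible relation *)

Lemma surjection_bijective (G V : finType) (f : G -> V) :
  (forall v, exists g, f g = v) -> (#|G| <= #|V|)%N -> bijective f.
Proof.
move=> /boolp.choice[h hK] leGV.
have h_bij : bijective h by apply: inj_card_bij leGV; apply: can_inj hK.
exact: (bij_can_bij h_bij hK).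
Qed.

Section FiniteQuasigroup.
Variables (G : finType) (phi : G -> G -> G).
Hypothesis phi_biperm : bipermutative phi.

Lemma left_translation_inj a : injective (phi a).
Proof. exact/bij_inj/phi_biperm.1. Qed.

Lemma right_translation_inj a : injective (phi^~ a).
Proof. exact/bij_inj/phi_biperm.2. Qed.

Lemma right_divisible a c : exists b, phi a b = c.
Proof. by have [h _ hK] := phi_biperm.1 a; exists (h c). Qed.

(** Right translation by [c], where [phi g c = h], maps the fiber of [g]
    injectively into the fiber of [h], and [g] and [h] are arbitrary. *)
Lemma card_fiber (T : eqType) (q : G -> T) :
  (forall g g' h, q g = q g' -> q (phi g h) = q (phi g' h)) ->
  forall g h, #|[pred x | q x == q g]| = #|[pred x | q x == q h]|.
Proof.
move=> q_mul g0 h0.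
suff le g h : (#|[pred x | q x == q g]| <= #|[pred x | q x == q h]|)%N.
  by apply/eqP; rewrite eqn_leq !le.
have [c <-] := right_divisible g h.
rewrite -(fintype.card_image (@right_translation_inj c)).
apply/subset_leq_card/fintype.subsetP.
by move=> _ /fintype.imageP[x /eqP qx ->]; rewrite inE (q_mul _ _ _ qx).
Qed.

Section CompatibleRelation.
Variable E : rel G.
Hypothesis E_mul : forall a b c d, E a b -> E c d -> E (phi a c) (phi b d).

(** Translation by [(a, b)] permutes the finite set of pairs of [E], so [E] is
    closed under division too. *)
Lemma compatible_division a b u v :
  E a b -> E (phi a u) (phi b v) -> E u v.
Proof.
move=> Eab Euv.
pose m (p : G * G) := (phi a p.1, phi b p.2).
have m_inj : injective m.
  move=> [x y] [x' y'] [e e'].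
  by rewrite (left_translation_inj e) (left_translation_inj e').
pose S := [set p : G * G | E p.1 p.2]%SET.
have mS : (m @: S = S)%SET.
  apply/eqP; rewrite eqEcard (card_imset _ m_inj) leqnn andbT.
  by apply/fintype.subsetP => _ /imsetP[p + ->]; rewrite !inE; apply: E_mul.
have : m (u, v) \in S by rewrite inE.
by rewrite -mS mem_imset // inE.
Qed.

Hypothesis E_succ : forall a, exists b, E a b.
Hypothesis E_pred : forall b, exists a, E a b.

Let F a := [set b | E a b]%SET.

Lemma card_followers_le a b : (#|F a| <= #|F (phi a b)|)%N.
Proof.
have [c Ebc] := E_succ b.
rewrite -(card_imset _ (@right_translation_inj c)); apply/subset_leq_card.
by apply/fintype.subsetP => _ /imsetP[x + ->]; rewrite !inE => /E_mul; apply.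
Qed.

Lemma card_followers a b : #|F a| = #|F b|.
Proof.
have le x y : (#|F x| <= #|F y|)%N.
  by have [c <-] := right_divisible x y; apply: card_followers_le.
by apply/eqP; rewrite eqn_leq !le.
Qed.

Lemma followers_mul_right a b y :
  E b y -> (phi^~ y @: F a = F (phi a b))%SET.
Proof.
move=> Eby; apply/eqP; rewrite eqEcard (card_imset _ (@right_translation_inj y)).
rewrite (card_followers a (phi a b)) leqnn andbT.
by apply/fintype.subsetP => _ /imsetP[x + ->]; rewrite !inE => /E_mul; apply.
Qed.

Lemma followers_mul_left a b x :
  E a x -> (phi x @: F b = F (phi a b))%SET.
Proof.
move=> Eax; apply/eqP; rewrite eqEcard (card_imset _ (@left_translation_inj x)).
rewrite (card_followers b (phi a b)) leqnn andbT.
by apply/fintype.subsetP => _ /imsetP[y + ->]; rewrite !inE; apply: E_mul.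
Qed.

(** [F (phi a b)] is at once a right translate of [F a] by any element of [F b] and a
    left translate of [F b] by any element of [F a].  A common element [y] of
    [F b] and [F b'] thus gives [F (phi b b) = F (phi b b')], and cancelling a
    left translation gives [F b = F b']. *)
Lemma common_follower b b' y : E b y -> E b' y -> F b = F b'.
Proof.
move=> Eby Eb'y; have [x Ebx] := E_succ b.
apply: (imset_inj (@left_translation_inj x)).
rewrite (followers_mul_left _ Ebx) (followers_mul_left _ Ebx).
by rewrite -(followers_mul_right _ Eby) -(followers_mul_right _ Eb'y).
Qed.

Lemma followers_congr a a' b b' :
  F a = F a' -> F b = F b' -> F (phi a b) = F (phi a' b').
Proof.
move=> Faa' Fbb'; have [y Eby] := E_succ b.
have Eb'y : E b' y.
  have : y \in F b' by rewrite -Fbb' inE.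
  by rewrite inE.
by rewrite -(followers_mul_right _ Eby) Faa' (followers_mul_right _ Eb'y).
Qed.

(** The vertices are the follower sets, [t a] is the follower set of [a] and
    [s b] the follower set of any predecessor of [b], that is, the one follower
    set containing [b]. *)
Lemma edge_presentation : exists (V : finType) (mul : V -> V -> V) (s t : G -> V),
  [/\ bipermutative mul,
      (forall v, exists g, s g = v) /\ (forall v, exists g, t g = v),
      {morph s : a b / phi a b >-> mul a b},
      {morph t : a b / phi a b >-> mul a b} &
      forall a b, E a b = (t a == s b)].
Proof.
pose V := {S : {set G} | S \in codom F}.
pose t a : V := exist _ (F a) (codom_f F a).
pose rep (v : V) : G := iinv (svalP v).
have repK v : t (rep v) = v by apply/val_inj; rewrite /= f_iinv.
pose prec b := xchoose (E_pred b).
have precP b : E (prec b) b by exact: (xchooseP (E_pred b)).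
pose s b := t (prec b).
pose mul v w := t (phi (rep v) (rep w)).
have tE a a' : t a = t a' <-> F a = F a'.
  by split=> [/(congr1 val)|e] //; apply/val_inj.
have t_mul : {morph t : a b / phi a b >-> mul a b}.
  by move=> a b; apply/tE/followers_congr; apply/tE; rewrite repK.
have s_mul : {morph s : a b / phi a b >-> mul a b}.
  move=> a b; rewrite /s -t_mul; apply/tE.
  by apply: (@common_follower _ _ (phi a b)); rewrite ?precP //; apply: E_mul.
have t_surj v : exists g, t g = v by exists (rep v).
have ts a b : E a b = (t a == s b).
  apply/idP/eqP => [Eab|/tE Fab]; first exact/tE/(common_follower Eab).
  have : b \in F a by rewrite Fab inE precP.
  by rewrite inE.
have s_surj v : exists g, s g = v.
  have [a <-] := t_surj v; have [b] := E_succ a.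
  by rewrite ts => /eqP ->; exists b.
exists V, mul, s, t; split=> //; split=> v; apply: surjection_bijective => // w.
  have [a <-] := t_surj v; have [b <-] := t_surj w.
  by have [c <-] := right_divisible a b; exists (t c).
have [a <-] := t_surj v; have [b <-] := t_surj w.
by have [h _ hK] := phi_biperm.2 a; exists (t (h b)); rewrite -t_mul hK.
Qed.
End CompatibleRelation.
End FiniteQuasigroup.
(** * Splitting off full shifts *)

Lemma fiber_labelling (G : finType) (T : eqType) (q : G -> T) (k : nat) :
  (forall g, #|[pred x | q x == q g]| = k) ->
  exists label : G -> 'I_k,
    (forall g h, q g = q h -> label g = label h -> g = h) /\
    (forall g l, exists2 h, q h = q g & label h = l).
Proof.
move=> qk; pose e g := enum [pred x | q x == q g].
have mem_e g : g \in e g by rewrite mem_enum inE.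
have lt_k g : (index g (e g) < k)%N by rewrite -(qk g) cardE index_mem mem_e.
exists (fun g => Ordinal (lt_k g)); split=> [g h qgh [eq_ix]|g l].
  have e_eq : e g = e h by apply: eq_enum => x; rewrite !inE qgh.
  by rewrite -(nth_index g (mem_e g)) eq_ix e_eq nth_index.
have lt_l : (l < size (e g))%N by rewrite -cardE qk.
set h := nth g (e g) l.
have /eqP qh : q h == q g by have := mem_nth g lt_l; rewrite mem_enum inE.
have e_eq : e h = e g by apply: eq_enum => x; rewrite !inE qh.
by exists h => //; apply: val_inj; rewrite /= e_eq index_uniq ?enum_uniq.
Qed.

Definition walk (G : finType) (E : rel G) (x : int -> G) : Prop :=
  forall i, E (x i) (x (i + 1)).

(** The points of the product of the orbits of [pi] and the full shift on [B]. *)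
Definition orbit_walk (A B : finType) (pi : A -> A) (y : int -> A * B) : Prop :=
  forall i, (y (i + 1)).1 = pi (y i).1.

(** The combinatorial content of a conjugacy through [theta] between the walks of
    [E] and the product of the orbits of [pi] with the full shift on [B].
    Surjectivity is [splitting_lift]; injectivity, together with the fact that
    the inverse is a block code with memory [0] and anticipation [r], is
    [splitting_window].  The last field fixes the size of [B] when there
    are no letters, where [splitting_degree] says nothing. *)
Record splitting (G A B : finType) (E : rel G) (pi : A -> A)
    (theta : G -> A * B) (r : nat) : Prop := Splitting {
  splitting_bij : bijective pi;
  splitting_step : forall a b, E a b -> (theta b).1 = pi (theta a).1;
  splitting_lift : forall y, orbit_walk pi y ->
    exists2 x, walk E x & forall i, theta (x i) = y i;
  splitting_window : forall x x', walk E x -> walk E x' ->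
    forall i, (forall j, (j <= r)%N ->
      theta (x (i + j%:Z)) = theta (x' (i + j%:Z))) -> x i = x' i;
  splitting_letters : forall p, exists a, theta a = p;
  splitting_degree : forall a, #|E a| = #|B|;
  splitting_trivial : #|B| = 1%N \/ exists a : G, True
}.

(** With bijective [s] and [t] every letter has exactly one successor, and the
    full shift is the one on a single letter. *)
Lemma permutation_splitting (G V : finType) (E : rel G) (s t : G -> V) :
  bijective s -> bijective t -> (forall a b, E a b = (t a == s b)) ->
  exists (pi : G -> G), splitting E pi (fun g => (g, tt)) 0.
Proof.
move=> [s' sK s'K] t_bij Ets.
have Epi a b : E a b = (b == s' (t a)).
  by rewrite Ets; apply/eqP/eqP => [->|->]; rewrite ?sK ?s'K.
exists (s' \o t); split=> /=.
- by apply: bij_comp t_bij; exists s.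
- by move=> a b; rewrite Epi => /eqP.
- move=> y y_orbit; exists (fun i => (y i).1) => [i|i].
    by rewrite Epi y_orbit.
  by case: (y i) => a [].
- move=> x x' _ _ i /(_ 0%N isT) []; by rewrite addr0.
- by case=> a []; exists a.
- move=> a; rewrite card_unit -(card1 (s' (t a))).
  by apply: eq_card => b; rewrite !inE -Epi.
- by left; rewrite card_unit.
Qed.

(** A walk in the edges is a walk in the vertices together with a free choice,
    at each step, among the [k] parallel edges.  The edge at [i] is recovered
    from its number and the vertices at [i] and [i + 1], which costs one more
    unit of anticipation. *)
Lemma extend_splitting (G V A B : finType) (E : rel G) (E' : rel V) (s t : G -> V)
    (pi : A -> A) (theta : V -> A * B) (r k : nat) (g0 : G) :
  (forall v, exists g, s g = v) ->
  (forall a b, E a b = (t a == s b)) ->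
  (forall v w, reflect (exists2 g, s g = v & t g = w) (E' v w)) ->
  (forall g, #|[pred x | (s x, t x) == (s g, t g)]| = k) ->
  splitting E' pi theta r ->
  exists theta' : G -> A * (B * 'I_k)%type, splitting E pi theta' r.+1.
Proof.
move=> s_surj Ets E'P st_k [pi_bij step lift window letters degree _].
have [label [label_inj label_surj]] := fiber_labelling st_k.
have E'_st g : E' (s g) (t g) by apply/E'P; exists g.
have walk_s x : walk E x -> walk E' (s \o x).
  by move=> Ex i /=; have := Ex i; rewrite Ets => /eqP <-.
exists (fun g => ((theta (s g)).1, ((theta (s g)).2, label g))); split=> //=.
- by move=> a b; rewrite Ets => /eqP <-; apply: step.
- move=> y y_orbit.
  have [v Ev v_y] := lift (fun i => ((y i).1, (y i).2.1)) y_orbit.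
  have /boolp.choice[x xP] i : exists g,
      [/\ s g = v i, t g = v (i + 1) & label g = (y i).2.2].
    have /E'P[g sg tg] := Ev i.
    have [h [sh th] lh] := label_surj g (y i).2.2.
    by exists h; rewrite sh th.
  exists x => [i|i].
    by rewrite Ets; have [_ -> _] := xP i; have [-> _ _] := xP (i + 1).
  by have [-> _ ->] := xP i; rewrite v_y /=; case: (y i) => a [].
- move=> x x' Ex Ex' i xx'.
  have same_s j : (j <= 1)%N -> s (x (i + j%:Z)) = s (x' (i + j%:Z)).
    move=> j1; apply: (window _ _ (walk_s _ Ex) (walk_s _ Ex')) => l lr /=.
    rewrite -!addrA -!PoszD; have /xx'[] : (j + l <= r.+1)%N by lia.
    by case: (theta _) (theta _) => ? ? [? ?] /= -> ->.
  apply: label_inj; last first.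
    by have [] := xx' 0%N isT; rewrite addr0.
  congr pair; first by have := same_s 0%N isT; rewrite addr0.
  have := Ex i; rewrite Ets => /eqP ->; have := Ex' i; rewrite Ets => /eqP ->.
  exact: (same_s 1%N).
- move=> [a [b l]]; have [v tv] := letters (a, b).
  have [g sg] := s_surj v; have [h [sh _] lh] := label_surj g l.
  by exists h; rewrite sh sg tv lh.
- move=> a; rewrite card_prod card_ord -(degree (t a)).
  rewrite -[k in RHS]card_ord -cardX.
  have f_inj : {in E a &, injective (fun g => (t g, label g))}.
    move=> g h; rewrite !unfold_in !Ets => /eqP sg /eqP sh [tgh lgh].
    by apply: label_inj; rewrite // -sg -sh tgh.
  rewrite -(card_in_image f_inj); apply: eq_card => -[w l].
  rewrite !inE andbT; apply/fintype.imageP/E'P => [[g]|[g sg tg]].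
    by rewrite unfold_in Ets => /eqP -> [-> _]; exists g.
  have [h [sh th] lh] := label_surj g l.
  by exists h; rewrite ?unfold_in ?Ets ?sh ?sg ?th ?tg ?lh.
- by right; exists g0.
Qed.

(** Induction on the number of letters, which decreases unless every letter has
    a single successor. *)
Theorem markov_splitting (G : finType) (phi : G -> G -> G) (E : rel G) :
  bipermutative phi ->
  (forall a b c d, E a b -> E c d -> E (phi a c) (phi b d)) ->
  (forall a, exists b, E a b) -> (forall b, exists a, E a b) ->
  exists (A B : finType) (pi : A -> A) (theta : G -> A * B) (r : nat),
    splitting E pi theta r.
Proof.
have [n] := ubnP #|G|; elim: n => // n IHn in G phi E *; rewrite ltnS => leGn.
move=> phi_biperm E_mul E_succ E_pred.
have [V [mul [s [t [mul_biperm [s_surj t_surj] s_mul t_mul Ets]]]]] :=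
  edge_presentation phi_biperm E_mul E_succ E_pred.
have [leGV|ltVG] := leqP #|G| #|V|.
  have s_bij := surjection_bijective s_surj leGV.
  have t_bij := surjection_bijective t_surj leGV.
  have [pi piP] := permutation_splitting s_bij t_bij Ets.
  by exists G, unit, pi, (fun g => (g, tt)), 0%N.
have [g0 _] : exists g0 : G, predT g0 by apply/card_gt0P; apply: leq_ltn_trans ltVG.
pose E' v w := [exists g, (s g == v) && (t g == w)].
have E'P v w : reflect (exists2 g, s g = v & t g = w) (E' v w).
  apply: (iffP existsP) => [[g /andP[/eqP sg /eqP tg]]|[g <- <-]]; exists g => //.
  by rewrite !eqxx.
have [A [B [pi [theta [r split]]]]] : exists (A B : finType) (pi : A -> A)
    (theta : V -> A * B) (r : nat), splitting E' pi theta r.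
  apply: (IHn _ mul); rewrite ?(leq_trans ltVG) //.
  - move=> a b c d /E'P[g <- <-] /E'P[h <- <-]; apply/E'P.
    by exists (phi g h); rewrite ?s_mul ?t_mul.
  - by move=> v; have [g <-] := s_surj v; exists (t g); apply/E'P; exists g.
  - by move=> v; have [g <-] := t_surj v; exists (s g); apply/E'P; exists g.
have st_mul g g' h : (s g, t g) = (s g', t g') ->
    (s (phi g h), t (phi g h)) = (s (phi g' h), t (phi g' h)).
  by rewrite !s_mul !t_mul => -[-> ->].
have st_k g := card_fiber phi_biperm st_mul g g0.
have [theta' split'] := extend_splitting g0 s_surj Ets E'P st_k split.
by exists A, (B * 'I_ _)%type, pi, theta', r.+1.
Qed.

Lemma relabel_splitting (G A B B' : finType) (E : rel G) (pi : A -> A)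
    (theta : G -> A * B) (r : nat) (e : B -> B') :
  bijective e -> splitting E pi theta r ->
  splitting E pi (fun g => ((theta g).1, e (theta g).2)) r.
Proof.
move=> e_bij; have [e' eK e'K] := e_bij; have cardB := bij_eq_card e_bij.
case=> pi_bij step lift window letters degree trivial.
split; rewrite -?cardB //=.
- move=> y y_orbit; have [x Ex xy] := lift (fun i => ((y i).1, e' (y i).2)) y_orbit.
  by exists x => // i; rewrite xy /= e'K; case: (y i).
- move=> x x' Ex Ex' i xx'; apply: window => // j /xx'[].
  by case: (theta _) (theta _) => [? ?] [? ?] /= -> /(can_inj eK) ->.
- move=> [a b']; have [g tg] := letters (a, e' b').
  by exists g; rewrite tg /= e'K.
Qed.

Corollary markov_splitting_ordinal (G : finType) (phi : G -> G -> G) (E : rel G) :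
  bipermutative phi ->
  (forall a b c d, E a b -> E c d -> E (phi a c) (phi b d)) ->
  (forall a, exists b, E a b) -> (forall b, exists a, E a b) ->
  exists (A : finType) (n : nat) (pi : A -> A) (theta : G -> A * 'I_n) (r : nat),
    splitting E pi theta r.
Proof.
move=> phi_biperm E_mul E_succ E_pred.
have [A [B [pi [theta [r split]]]]] :=
  markov_splitting phi_biperm E_mul E_succ E_pred.
exists A, #|B|, pi, (fun g => ((theta g).1, enum_rank (theta g).2)), r.
exact: relabel_splitting (@enum_rank_bij B) split.
Qed.

(** * Topological Markov chains as sets of walks *)

Lemma coordinate_near (A : finType) (x : config A) (i : int) :
  \forall y \near x, y i = x i.
Proof.
have := @proj_continuous _ (fun _ : int => discrete_topology A) i x.
by move=> /(_ _ (discrete_set1 (x i))).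
Qed.

Lemma config_cvg (A : finType) (F : set_system (config A)) (x : config A) :
  Filter F -> (forall i, \forall y \near F, y i = x i) -> F --> x.
Proof.
move=> FF Fx; apply/cvg_sup => i U [_ [[B oB <-] Bx] BU].
by apply: filterS (Fx i) => y yx; apply: BU; rewrite /preimage /= yx.
Qed.

(** Settles the filter structure of [nbhs x] at once; the search would otherwise
    look for a pointed structure on the alphabet. *)
#[local] Instance config_nbhs_filter (A : finType) (x : config A) :
  ProperFilter (nbhs x).
Proof. exact: nbhs_pfilter. Qed.

Lemma locally_determined_continuous (A B : finType) (f : config A -> config B) :
  (forall x i, \forall y \near x, f y i = f x i) -> continuous f.
Proof.
move=> f_loc x; apply: (@config_cvg B (f @ x) (f x)) => i.
exact: (f_loc x i).
Qed.

(** Cylinders around [0] are a neighbourhood basis, so a closed set contains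
    every point that it approximates on all windows. *)
Lemma closed_config (A : finType) (X : set (config A)) (x : config A) :
  closed X ->
  (forall n : nat, exists2 z, X z &
    forall i : int, (`|i| <= n)%N -> z i = x i) -> X x.
Proof.
move=> X_closed x_approx.
have /boolp.choice[z zP] n : exists z, X z /\
    forall i : int, (`|i| <= n)%N -> z i = x i.
  by have [z Xz zx] := x_approx n; exists z.
have zX : \forall n \near \oo, X (z n) by apply: nearW => n; case: (zP n).
have z_cvg : z n @[n --> \oo] --> x.
  apply: config_cvg => i; exists `|i|%N => // n le_in; exact: (zP n).2.
exact: (@closed_cvg _ _ \oo _ z X X_closed zX x z_cvg).
Qed.

Lemma subshift_translate (A : finType) (X : set (config A)) (x : config A) (n : int) :
  subshift X -> X x -> X (fun i => x (i + n)).
Proof.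
case=> _ XE Xx.
have fwd y : X y -> X (shift_map y) by move=> Xy; rewrite -XE; exists y.
have bwd y : X y -> X (fun i => y (i - 1)).
  rewrite -{1}XE => -[z Xz <-]; congr (X _): Xz.
  by apply/funext => i; rewrite /shift_map subrK.
case: n => n.
  elim: n => [|n /fwd]; first by congr (X _): Xx; apply/funext => i; rewrite addr0.
  by congr (X _); apply/funext => i; rewrite /shift_map; congr (x _); lia.
elim: n => [|n /bwd]; first by move/bwd: Xx.
by congr (X _); apply/funext => i; congr (x _); lia.
Qed.

Definition word_at (A : finType) (x : int -> A) (i : int) (n : nat) : seq A :=
  [seq x (i + j%:Z) | j <- iota 0 n].

Lemma word_atS (A : finType) (x : int -> A) i n :
  word_at x i n.+1 = rcons (word_at x i n) (x (i + n%:Z)).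
Proof. by rewrite /word_at -addn1 iotaD map_cat cats1. Qed.

Lemma word_at_cons (A : finType) (x : int -> A) i n :
  word_at x i n.+1 = x i :: word_at x (i + 1) n.
Proof.
rewrite /word_at /= addr0 -[1%N]addn0 iotaDl -map_comp; congr cons.
by apply: eq_map => j /=; rewrite -addrA.
Qed.

Lemma size_word_at (A : finType) (x : int -> A) i n : size (word_at x i n) = n.
Proof. by rewrite size_map size_iota. Qed.

Lemma nth_word_at (A : finType) (x : int -> A) a i n j :
  (j < n)%N -> nth a (word_at x i n) j = x (i + j%:Z).
Proof. by move=> jn; rewrite (nth_map 0%N) ?size_iota // nth_iota. Qed.

Lemma allowed_word_at (A : finType) (X : set (config A)) x i n :
  X x -> allowed X (word_at x i n).
Proof. by move=> Xx; exists x => //; exists i; rewrite size_word_at. Qed.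

Lemma allowed_at (A : finType) (X : set (config A)) (w : seq A) (i : int) :
  subshift X -> allowed X w -> exists2 x, X x & w = word_at x i (size w).
Proof.
move=> X_shift [x Xx [k wE]].
exists (fun j => x (j + (k - i))).
  exact: (subshift_translate (k - i) X_shift Xx).
rewrite {1}wE; apply: eq_map => j; congr (x _); lia.
Qed.

Definition successor (A : finType) (X : set (config A)) : rel A :=
  fun a b => `[< allowed X [:: a; b] >].

Lemma successorP (A : finType) (X : set (config A)) a b : subshift X ->
  reflect (exists2 x, X x & x 0 = a /\ x 1 = b) (successor X a b).
Proof.
move=> X_shift; apply: (iffP (asboolP _)).
  by move=> /(allowed_at 0 X_shift)[x Xx [-> ->]]; exists x.
by move=> [x Xx [<- <-]]; apply: (allowed_word_at 0 2 Xx).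
Qed.

Lemma word_at_path (A : finType) (E : rel A) (x : int -> A) i n :
  walk E x -> path E (x i) (word_at x (i + 1) n).
Proof.
move=> x_walk; elim: n => // n IHn; rewrite word_atS rcons_path IHn /=.
suff -> : last (x i) (word_at x (i + 1) n) = x (i + n%:Z).
  by have := x_walk (i + n%:Z); rewrite addrAC.
case: n {IHn} => [|n]; first by rewrite addr0.
by rewrite word_atS last_rcons -addrA -PoszD.
Qed.

Lemma subshift_walk (A : finType) (X : set (config A)) (x : config A) :
  subshift X -> X x -> walk (successor X) x.
Proof.
move=> X_shift Xx i; apply/successorP => //.
exists (fun j => x (j + i)); first exact: (subshift_translate i X_shift Xx).
by rewrite add0r addrC.
Qed.

(** Whether [b] may be appended to a word depends only on its last letter, so
    allowed words grow one allowed pair at a time. *)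
Lemma allowed_path (A : finType) (X : set (config A)) a w :
  topological_Markov_chain X -> uses_all_letters X ->
  allowed X (a :: w) <-> path (successor X) a w.
Proof.
move=> [X_shift X_follow] X_letters; split.
  move=> /(allowed_at 0 X_shift)[x Xx]; rewrite /= word_at_cons => -[-> ->].
  exact/word_at_path/subshift_walk.
elim/last_ind: w => [_|w b IHw]; first exact: X_letters.
rewrite rcons_path => /andP[/IHw aw_allowed /asboolP E_b].
suff : followers X (a :: w) b by [].
rewrite lastI in aw_allowed *.
by rewrite (X_follow _ [::] _ aw_allowed (X_letters _)).
Qed.

(** Every central window of a walk is allowed by [allowed_path], so a walk is a
    limit of points of the closed set [X]. *)
Lemma Markov_chain_walks (A : finType) (X : set (config A)) :
  topological_Markov_chain X -> uses_all_letters X ->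
  X = [set x | walk (successor X) x].
Proof.
move=> X_tmc X_letters; have X_shift := X_tmc.1.
apply/seteqP; split=> x /=; first exact: subshift_walk.
move=> x_walk; apply: closed_config X_shift.1 _ => n.
have /(allowed_at (- n%:Z) X_shift)[z Xz] :=
  (allowed_path _ _ X_tmc X_letters).2 (word_at_path (- n%:Z) (n + n)%N x_walk).
rewrite -word_at_cons size_word_at => zx; exists z => // i le_in.
have [j ji jn] : exists2 j : nat, i = - n%:Z + j%:Z & (j < (n + n).+1)%N.
  by exists (absz (i + n%:Z)); lia.
have /(congr1 (fun w => nth (x 0) w j)) := zx.
by rewrite !nth_word_at // -ji.
Qed.

Lemma successor_mul (A : finType) (X : set (config A)) (phi : A -> A -> A) :
  subshift X -> structurally_compatible X phi ->
  forall a b c d, successor X a b -> successor X c d ->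
    successor X (phi a c) (phi b d).
Proof.
move=> X_shift phi_compat a b c d /successorP -/(_ X_shift)[x Xx [<- <-]].
move=> /successorP -/(_ X_shift)[y Xy [<- <-]]; apply/successorP => //.
by exists (fun i => phi (x i) (y i)) => //; apply: phi_compat.
Qed.

Lemma letter_at (A : finType) (X : set (config A)) a (i : int) :
  subshift X -> uses_all_letters X -> exists2 x, X x & x i = a.
Proof.
move=> X_shift /(_ a)/(allowed_at i X_shift)[x Xx [->]].
by exists x => //; rewrite addr0.
Qed.

(** * Topological entropy *)

Section CoverNumbers.
Variables (R : realType) (T : topologicalType) (X : set T) (U : set (set T)).

Definition subcover (D : {fset (set T)}) : Prop :=
  [set` D] `<=` U /\ X `<=` \bigcup_(u in [set` D]) u.

Lemma cover_number_le D : subcover D -> cover_number R X U <= (#|` D|)%:R.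
Proof.
by move=> D_cover; apply: ge_inf; [exists 0 => _ [E _ <-] | exists D].
Qed.

Lemma cover_number_ge D (c : R) : subcover D ->
  (forall D', subcover D' -> c <= (#|` D'|)%:R) -> c <= cover_number R X U.
Proof.
move=> D_cover c_le; apply: lb_le_inf; first by exists (#|` D|)%:R, D.
by move=> _ [E E_cover <-]; apply: c_le.
Qed.

End CoverNumbers.

Lemma iterated_join_cover (T : topologicalType) (X : set T) (f : T -> T)
    (U : set (set T)) n :
  (forall x, X x -> X (f x)) -> X `<=` \bigcup_(u in U) u ->
  X `<=` \bigcup_(u in iterated_join f U n) u.
Proof.
move=> fX U_cover x Xx; elim: n => [|n [u Uu ux]]; first by exists setT.
have [v Uv vx] : exists2 v, U v & v (iter n f x).
  have Xn : X (iter n f x) by elim: (n) => //= m; apply: fX.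
  by have [v Uv vx] := U_cover _ Xn; exists v.
exists (u `&` iter n f @^-1` v) => //=.
by exists u => //; exists (iter n f @^-1` v) => //; exists v.
Qed.

(** One member of the cover for each point of [S] suffices.  If [S] is empty,
    both cardinals are [0], and [ln 0 = 0]. *)
Lemma ln_cover_number_bounds (R : realType) (T : topologicalType) (S : {fset T})
    (U : set (set T)) :
  [set` S] `<=` \bigcup_(u in U) u ->
  0 <= ln (cover_number R [set` S] U) <= ln (#|` S|%:R : R).
Proof.
move=> U_cover.
have /boolp.choice[u uP] x : exists u, x \in S -> U u /\ u x.
  have [xS|/negP xS] := boolP (x \in S); last by exists set0.
  by have [u Uu ux] := U_cover x xS; exists u.
pose D := [fset u x | x in S]%fset.
have D_cover : subcover [set` S] U D.
  split=> [_ /imfsetP[x /= xS ->]|x /= xS]; first exact: (uP x xS).1.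
  by exists (u x); [apply: in_imfset | apply: (uP x xS).2].
have le_S : cover_number R [set` S] U <= #|` S|%:R.
  apply: le_trans (cover_number_le R D_cover) _.
  by rewrite ler_nat; apply: leq_trans (leq_imfset_card _ _ _) _.
have [S0|[x xS]] := fset_0Vmem S.
  have N0 : cover_number R [set` S] U <= 0 by move: le_S; rewrite S0 cardfs0.
  by rewrite (ln0 N0) S0 cardfs0 (ln0 (lexx 0)) lexx.
have ge1 : 1 <= cover_number R [set` S] U.
  apply: (cover_number_ge D_cover) => D' [_ /(_ x xS)[v vD _]].
  by rewrite ler1n cardfs_gt0; apply/fset0Pn; exists v.
have N_gt0 := lt_le_trans ltr01 ge1.
by rewrite ln_ge0 //= ler_ln ?posrE ?(lt_le_trans N_gt0 le_S).
Qed.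

(** The cover numbers stay bounded by the number of points. *)
Lemma entropy_finite (R : realType) (T : topologicalType) (X : set T) (f : T -> T) :
  finite_set X -> (forall x, X x -> X (f x)) ->
  topological_entropy R X f = 0%:E.
Proof.
move=> /finite_fsetP[S ->] fS.
suff cover0 U : open_cover [set` S] U -> cover_entropy R [set` S] f U = 0.
  have coverT : open_cover [set` S] [set [set: T]].
    by split=> [_ ->|x _]; [apply: openT|exists setT].
  rewrite /topological_entropy -[RHS]ereal_sup1; congr ereal_sup.
  apply/seteqP; split=> [_ [U /cover0 -> <-]|_ ->] //.
  by exists [set setT] => //; rewrite cover0.
case=> _ U_cover; apply/cvg_lim => //.
rewrite -cvg_shiftS.
pose C : R := ln #|` S|%:R.
apply: (@squeeze_cvgr _ _ _ _ (fun=> 0) (fun n => C * n.+1%:R^-1)).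
- apply: nearW => n /=.
  have /andP[ge0 leC] :=
    ln_cover_number_bounds R (iterated_join_cover n.+1 fS U_cover).
  by rewrite divr_ge0 //= ler_wpM2r ?invr_ge0.
- exact: cvg_cst.
- rewrite -(mulr0 C); apply: cvgMr; exact: cvg_harmonic.
Qed.

Lemma card_paths (G : finType) (E : rel G) (m : nat) :
  (forall a, #|E a| = m) ->
  forall n a, #|[set t : n.-tuple G | path E a t]%SET| = (m ^ n)%N.
Proof.
move=> E_m; elim=> [|n IHn] a.
  rewrite expn0; apply/eqP/cards1P; exists [tuple].
  by apply/setP => t; rewrite !inE tuple0.
pose f (p : G * n.-tuple G) := [tuple of p.1 :: p.2].
have f_inj : injective f.
  move=> [b t] [c u] /(congr1 val) /= [-> tu].
  by congr pair; apply: val_inj.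
pose P := [set p : G * n.-tuple G | E a p.1 && path E p.1 p.2]%SET.
have -> : [set t : n.+1.-tuple G | path E a t]%SET = (f @: P)%SET.
  apply/setP => t; rewrite inE; apply/idP/imsetP => [|[p + ->]]; last by rewrite inE.
  case/tupleP: t => b t /= ab_t; exists (b, t); first by rewrite inE.
  by apply: val_inj.
rewrite card_imset // -sum1_card.
transitivity (\sum_(b | E a b) \sum_(t in [set t : n.-tuple G | path E b t]%SET) 1)%N.
  by rewrite pair_big_dep /=; apply: eq_bigl => p; rewrite !inE.
under eq_bigr => b _ do rewrite sum1_card IHn.
by rewrite sum_nat_const E_m expnS.
Qed.

Definition cylinder (G : finType) (w : seq G) : set (config G) :=
  [set x | word_at x 0 (size w) = w].

Definition letter_cylinders (G : finType) : set (set (config G)) :=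
  [set [set x : config G | x 0 = g] | g in [set: G]].
Arguments letter_cylinders : clear implicits.

Lemma letter_cylinders_cover (G : finType) (X : set (config G)) :
  open_cover X (letter_cylinders G).
Proof.
split=> [_ [g _ <-]|x _]; last first.
  by exists [set y : config G | y 0 = x 0]; first exists (x 0).
rewrite openE => x /= <-; exact: coordinate_near.
Qed.

Lemma iter_shift (G : finType) (n : nat) (x : config G) i :
  iter n (@shift_map G) x i = x (i + n%:Z).
Proof.
elim: n i => [|n IHn] i; first by rewrite addr0.
rewrite iterS /shift_map IHn; congr (x _); lia.
Qed.

(** Words that do not occur in the chain contribute cylinders disjoint from it;
    they belong to the join all the same. *)
Lemma iterated_join_cylinders (G : finType) n :
  iterated_join (@shift_map G) (letter_cylinders G) n =
  [set cylinder w | w in [set w : seq G | size w = n]].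
Proof.
have cyl_rcons (w : seq G) g : cylinder (rcons w g) =
    cylinder w `&` iter (size w) (@shift_map G) @^-1` [set x : config G | x 0 = g].
  apply/seteqP; rewrite /cylinder size_rcons.
  split=> x /=; rewrite iter_shift word_atS add0r.
    by move=> /rcons_inj[-> ->].
  by move=> [-> ->].
elim: n => [|n IHn] /=.
  apply/seteqP; split=> [_ ->|_ [[] // _ <-]].
    by exists [::] => //; apply/seteqP; split.
  by apply/seteqP; split.
rewrite IHn; apply/seteqP; split=> [_ [_ [w <- <-] [_ [_ [g _ <-] <-] ->]]|_ [w + <-]].
  by exists (rcons w g); rewrite /= ?size_rcons ?cyl_rcons.
case/lastP: w => // w g; rewrite /= size_rcons => -[wn].
exists (cylinder w); first by exists w.
exists (iter n (@shift_map G) @^-1` [set x : config G | x 0 = g]).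
  by exists [set x : config G | x 0 = g] => //; exists g.
by rewrite cyl_rcons wn.
Qed.

(** The cylinders are pairwise disjoint and those of allowed words meet [X], so
    these form a subcover contained in every other one, and the cover number is
    the number of allowed words. *)
Lemma cover_number_cylinders (R : realType) (G : finType) (X : set (config G))
    (m n : nat) :
  topological_Markov_chain X -> uses_all_letters X ->
  (forall a, #|successor X a| = m) ->
  cover_number R X (iterated_join (@shift_map G) (letter_cylinders G) n.+1) =
  (#|G| * m ^ n)%:R.
Proof.
move=> X_tmc X_letters X_m; have X_shift := X_tmc.1.
rewrite iterated_join_cylinders; set U := [set _ | _ in _].
pose P := [set p : G * n.-tuple G | path (successor X) p.1 p.2]%SET.
have card_P : #|P| = (#|G| * m ^ n)%N.
  pose Q a := [set t : n.-tuple G | path (successor X) a t]%SET.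
  transitivity (\sum_(a in G) #|Q a|)%N.
    rewrite -sum1_card (eq_bigl (fun p => xpredT p.1 && (p.2 \in Q p.1))).
      rewrite -(pair_big_dep xpredT (fun a t => t \in Q a) (fun _ _ => 1%N)) /=.
      by apply: eq_bigr => a _; rewrite sum1_card.
    by move=> p; rewrite !inE.
  under eq_bigr => a _ do rewrite (card_paths X_m).
  by rewrite sum_nat_const.
pose cyl (p : G * n.-tuple G) := cylinder (p.1 :: p.2).
have P_point p : p \in P -> exists2 x, X x & word_at x 0 n.+1 = p.1 :: p.2.
  rewrite inE => /(allowed_path _ _ X_tmc X_letters).
  move=> /(allowed_at 0 X_shift)[x Xx]; rewrite /= size_tuple => xp.
  by exists x.
have cylE p x : cyl p x <-> word_at x 0 n.+1 = p.1 :: p.2.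
  by rewrite /cyl /cylinder /= size_tuple.
pose D := [fset cyl p | p in P]%fset.
have card_D : #|` D| = #|P|.
  rewrite card_in_imfset -?cardE // => p q /= pP qP pq.
  have [x Xx xp] := P_point p pP.
  have : cyl q x by rewrite -pq; apply/cylE.
  move/cylE; rewrite xp; case: p q {pP qP pq xp} => [a t] [b u] /= [-> tu].
  by congr pair; apply: val_inj.
have X_P x : X x -> exists2 p, p \in P & word_at x 0 n.+1 = p.1 :: p.2.
  move=> Xx; have sz : size (word_at x (0 + 1) n) == n by rewrite size_word_at.
  exists (x 0, Tuple sz); last by rewrite word_at_cons.
  by rewrite inE; apply/word_at_path/subshift_walk.
have D_cover : subcover X U D.
  split=> [_ /imfsetP[p /= _ ->]|x Xx].
    by exists (p.1 :: p.2 : seq G) => //=; rewrite size_tuple.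
  have [p pP xp] := X_P x Xx.
  by exists (cyl p); [apply: in_imfset | apply/cylE].
rewrite -card_P -card_D; apply/eqP; rewrite eq_le cover_number_le //=.
apply: (cover_number_ge D_cover) => D' [D'U D'_cover].
rewrite ler_nat; apply/fsubset_leq_card/fsubsetP => _ /imfsetP[p /= pP ->].
have [x Xx xp] := P_point p pP.
have [u uD' ux] := D'_cover x Xx.
suff <- : u = cyl p by [].
have [w /= wn u_w] := D'U u uD'; rewrite -u_w /cyl; congr cylinder.
by move: ux; rewrite -u_w /cylinder /= wn xp.
Qed.

(** The cover by the letters has entropy [ln m], a genuine limit since the cover
    numbers are known exactly. *)
Lemma entropy_positive (R : realType) (G : finType) (X : set (config G)) (m : nat) :
  topological_Markov_chain X -> uses_all_letters X ->
  (forall a, #|successor X a| = m) -> (0 < #|G|)%N -> (1 < m)%N ->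
  topological_entropy R X (@shift_map G) <> 0%:E.
Proof.
move=> X_tmc X_letters X_m G_gt0 m_gt1 entropy0.
pose U := letter_cylinders G.
have lnm : 0 < ln (m%:R : R) by rewrite ln_gt0 // ltr1n.
suff entropyU : cover_entropy R X (@shift_map G) U = ln m%:R.
  have : ((ln m%:R)%:E <= topological_entropy R X (@shift_map G))%E.
    apply: ereal_sup_ubound; exists U; first exact: letter_cylinders_cover.
    by rewrite entropyU.
  by rewrite entropy0 lee_fin leNgt lnm.
apply/cvg_lim => //; rewrite -cvg_shiftS.
pose C : R := ln #|G|%:R - ln m%:R.
have -> : [sequence
    ln (cover_number R X (iterated_join (@shift_map G) U n.+1)) / n.+1%:R]_n
    = (fun n => ln m%:R + C * n.+1%:R^-1).
  apply/funext => n /=; rewrite (cover_number_cylinders _ _ X_tmc X_letters X_m).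
  rewrite natrM natrX lnM ?posrE ?exprn_gt0 ?ltr0n ?(ltnW m_gt1) //.
  rewrite lnXn ?ltr0n ?(ltnW m_gt1) // /C.
  have n0 : (n.+1%:R : R) != 0 by rewrite pnatr_eq0.
  rewrite -mulr_natl -natr1 in n0 *.
  by field.
have : ln m%:R + C * n.+1%:R^-1 @[n --> \oo] --> ln m%:R + C * 0.
  apply: cvgD; first exact: cvg_cst.
  apply: cvgMr; exact: cvg_harmonic.
by rewrite mulr0 addr0.
Qed.

(** * Orbits of a permutation *)

Lemma orbit_eq (A : Type) (pi : A -> A) (x y : int -> A) (k : int) :
  injective pi -> (forall i, x (i + 1) = pi (x i)) ->
  (forall i, y (i + 1) = pi (y i)) -> x k = y k -> forall i, x i = y i.
Proof.
move=> pi_inj x_pi y_pi xyk i.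
suff xy n : x (k + n%:Z) = y (k + n%:Z) /\ x (k - n%:Z) = y (k - n%:Z).
  have [n [->|->]] : exists n : nat, i = k + n%:Z \/ i = k - n%:Z.
  - by exists (absz (i - k)); lia.
  - exact: (xy n).1.
  - exact: (xy n).2.
elim: n => [|n [IHp IHm]]; first by rewrite oppr0 addr0.
split.
  by rewrite -addn1 PoszD addrA x_pi y_pi IHp.
apply: pi_inj; rewrite -x_pi -y_pi.
by have -> : k - n.+1%:Z + 1 = k - n%:Z by lia.
Qed.

Lemma finite_of_letter0 (A : finType) (F : set (config A)) :
  (forall x y, F x -> F y -> x 0 = y 0 -> x = y) -> finite_set F.
Proof.
move=> F_inj.
have /boolp.choice[h hP] (a : A) :
    exists x : config A, forall y, F y -> y 0 = a -> y = x.
  have [[x [Fx xa]]|no] := pselect (exists x, F x /\ x 0 = a).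
    by exists x => y Fy ya; apply: F_inj => //; rewrite xa.
  by exists (constant_config a) => y Fy ya; case: no; exists y.
apply: (@sub_finite_set _ _ (h @` [set: A])).
  by move=> x Fx; exists (x 0) => //; rewrite -(hP _ x Fx).
exact/finite_image/finite_finset.
Qed.

Definition orbits (A : finType) (pi : A -> A) : set (config A) :=
  [set x | forall i, x (i + 1) = pi (x i)].

Lemma orbits_determined (A : finType) (pi : A -> A) (x y : config A) (k : int) :
  bijective pi -> orbits pi x -> orbits pi y -> x k = y k -> x = y.
Proof.
move=> /bij_inj pi_inj Fx Fy xy; apply/funext.
exact: (orbit_eq pi_inj Fx Fy xy).
Qed.

Lemma orbits_finite (A : finType) (pi : A -> A) :
  bijective pi -> finite_set (orbits pi).
Proof.
by move=> pi_bij; apply: finite_of_letter0 => x y; apply: orbits_determined.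
Qed.

Lemma orbits_subshift (A : finType) (pi : A -> A) : subshift (orbits pi).
Proof.
split=> [x x_clos i|].
  have [y [Fy [yi yi1]]] :=
    x_clos _ (filterI (coordinate_near x i) (coordinate_near x (i + 1))).
  by rewrite -yi -yi1.
apply/seteqP; split=> [_ [x Fx <-] i|x Fx]; first exact: Fx.
exists (fun i => x (i - 1)) => [i|].
  by have := Fx (i - 1); rewrite addrAC.
by apply/funext => i; rewrite /shift_map addrK.
Qed.

(** * The conjugacy and the transported operation *)

Section SplittingConjugacy.
Variables (G A B : finType) (E : rel G) (pi : A -> A) (theta : G -> A * B) (r : nat).
Hypothesis theta_split : splitting E pi theta r.

Definition encode (x : config G) : config (A * B)%type := fun i => theta (x i).

(** The window property, which compares two walks at one position, holds for two
    walks at two positions by translating one of them; hence the letter is a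
    function of the window. *)
Lemma window_rule : exists eta : r.+1.-tuple (A * B) -> G,
  forall x, walk E x -> forall i,
    x i = eta [tuple theta (x (i + (j : nat)%:Z)) | j < r.+1].
Proof.
pose win (x : int -> G) (i : int) :=
  [tuple theta (x (i + (j : nat)%:Z)) | j < r.+1].
have /boolp.choice[eta etaP] (t : r.+1.-tuple (A * B)) : exists g : G,
    forall x i, walk E x -> win x i = t -> x i = g.
  have [[x [i [Ex xt]]]|no] := pselect (exists x i, walk E x /\ win x i = t).
    exists (x i) => y k Ey yt.
    pose y' (l : int) := y (l + (k - i)).
    have -> : y k = y' i by rewrite /y'; congr (y _); lia.
    have Ey' : walk E y'.
      move=> l; rewrite /y'; have := Ey (l + (k - i)).
      by congr (E _ (y _)); lia.
    apply: (splitting_window theta_split Ey' Ex) => j jr.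
    have /(congr1 (fun s => tnth s (inord j))) : win y k = win x i by rewrite xt.
    rewrite !tnth_mktuple inordK // => <-; rewrite /y'; congr (theta (y _)); lia.
  have [g _] := splitting_letters theta_split (tnth t ord0).
  (* The window [t] does not occur, so any letter will do. *)
  by exists g => x i Ex xt; case: no; exists x, i.
by exists eta => x Ex i; apply: etaP.
Qed.

Lemma walk_orbits x : walk E x -> orbits pi (fst_config (encode x)).
Proof. by move=> Ex i; apply: (splitting_step theta_split (Ex i)). Qed.

Lemma splitting_inhabited : (0 < #|B|)%N.
Proof.
have [->//|[g _]] := splitting_trivial theta_split.
by apply/card_gt0P; exists (theta g).2.
Qed.

(** An orbit is determined by one letter, and [X] walks from its constant point
    to a preimage of any other orbit, which therefore is the constant one.
    Conversely, if there is only one orbit, two walks can be glued: left of the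
    gap the glued walk shows [r.+1] letters of the code of the first walk, enough
    to decode its letter at [0], and right of it the code of the second one. *)
Lemma irreducible_constant_orbits (X : set (config G)) :
  subshift X -> uses_all_letters X -> X = [set x | walk E x] ->
  irreducible_shift X /\ (exists g : G, X (constant_config g)) <->
  exists p : config A, orbits pi = [set p].
Proof.
move=> X_shift X_letters XE.
have [b _] : exists b : B, predT b by apply/card_gt0P; apply: splitting_inhabited.
have lift := splitting_lift theta_split.
have window := splitting_window theta_split.
have pi_bij := splitting_bij theta_split.
have X_walk x : X x -> walk E x by rewrite XE.
have walk_X x : walk E x -> X x by rewrite XE.
split.
  move=> [X_irr [g Xg]]; pose p := fst_config (encode (constant_config g)).
  have Fp : orbits pi p by apply/walk_orbits/X_walk.
  exists p; apply/seteqP; split=> [q Fq /=|_ ->] //.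
  have [x Ex xq] := lift (fun i => (q i, b)) Fq.
  have [v _ gvx] := X_irr g (x 0).
  have [y /X_walk Ey] := allowed_at 0 X_shift gvx.
  rewrite /= size_rcons word_at_cons word_atS => -[gy /rcons_inj[_ xy]].
  have yp : fst_config (encode y) = p.
    apply: (@orbits_determined _ pi _ _ 0) => //; first exact: walk_orbits.
    by rewrite /p /fst_config /encode -gy.
  apply: (@orbits_determined _ pi _ _ 0) => //.
  have -> : q 0 = (theta (x 0)).1 by rewrite xq.
  rewrite xy -[LHS]/(fst_config (encode y) _) yp.
  by [].
move=> [p Fp1].
have Fp : orbits pi p by rewrite Fp1.
have F_p q : orbits pi q -> q = p by rewrite Fp1.
split=> [u w|].
  have [x /X_walk Ex xu] := letter_at u 0 X_shift X_letters.
  have [y /X_walk Ey yw] := letter_at w (r.+2%:Z) X_shift X_letters.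
  pose z (i : int) := if i <= r%:Z then theta (x i) else theta (y i).
  have z_p i : (z i).1 = p i.
    rewrite /z; case: ifP => _.
      by rewrite -(F_p _ (walk_orbits Ex)).
    by rewrite -(F_p _ (walk_orbits Ey)).
  have z_orbit : orbit_walk pi z by move=> i; rewrite !z_p; apply: Fp.
  have [t Et tz] := lift z z_orbit.
  exists (word_at t 1 r.+1); first by rewrite size_word_at.
  have -> : u :: rcons (word_at t 1 r.+1) w = word_at t 0 r.+3.
    rewrite [RHS]word_at_cons [in RHS]word_atS add0r.
    congr (_ :: rcons _ _).
      rewrite -xu; apply: window => // j jr; rewrite tz /z ifT //; lia.
    rewrite -yw; apply: window => // j jr; rewrite tz /z ifF; last lia.
    congr (theta (y _)); lia.
  exact/allowed_word_at/walk_X.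
have p_shift i : p (i + 1) = p i.
  have : shift_map p = p by apply: F_p => i'; apply: Fp.
  by move/(congr1 (fun q => q i)).
have [x Ex xp] := lift (fun i => (p i, b)) Fp.
exists (x 0); apply: walk_X.
suff -> : constant_config (x 0) = x by [].
have Esx : walk E (shift_map x) by move=> l; apply: Ex.
have x_shift i : x (i + 1) = x i.
  by apply: (window _ _ Esx Ex i) => j _; rewrite /shift_map !xp p_shift.
exact/funext/(@orbit_eq _ id _ _ 0).
Qed.
End SplittingConjugacy.

Section Decoding.
Variables (G A B : finType) (E : rel G) (pi : A -> A) (theta : G -> A * B) (r : nat).
Hypothesis theta_split : splitting E pi theta r.

Definition decode (eta : r.+1.-tuple (A * B) -> G) (y : config (A * B)%type)
    : config G :=
  fun i => eta [tuple (y (i + (j : nat)%:Z) : A * B) | j < r.+1].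

Lemma exists_decode : exists eta : r.+1.-tuple (A * B) -> G,
  (forall x, walk E x -> decode eta (encode theta x) = x) /\
  (forall y, orbit_walk pi y ->
     walk E (decode eta y) /\ encode theta (decode eta y) = y).
Proof.
have [eta etaP] := window_rule theta_split.
have decodeK x : walk E x -> decode eta (encode theta x) = x.
  by move=> Ex; apply/funext => i; rewrite /decode -etaP.
exists eta; split=> // y y_orbit.
have [x Ex xy] := splitting_lift theta_split y_orbit.
have -> : y = encode theta x by apply/funext => i; rewrite /encode xy.
by rewrite decodeK.
Qed.

Lemma encode_continuous : continuous (encode theta).
Proof.
apply: locally_determined_continuous => x i.
by apply: filterS (coordinate_near x i) => y yx; rewrite /encode yx.
Qed.

Lemma decode_continuous eta : continuous (decode eta).
Proof.
apply: locally_determined_continuous => y i.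
have : \forall z \near y, forall j : 'I_r.+1,
    z (i + (j : nat)%:Z) = y (i + (j : nat)%:Z).
  have near_j (j : 'I_r.+1) := coordinate_near y (i + (j : nat)%:Z).
  exact: (filter_forall _ near_j).
apply: filterS => z zy; rewrite /decode; congr eta.
by apply: eq_mktuple => j; rewrite zy.
Qed.

Variable eta : r.+1.-tuple (A * B) -> G.
Hypothesis decodeK : forall x, walk E x -> decode eta (encode theta x) = x.
Hypothesis encodeK : forall y, orbit_walk pi y ->
  walk E (decode eta y) /\ encode theta (decode eta y) = y.

Lemma encode_orbit x : walk E x -> orbit_walk pi (encode theta x).
Proof. by move=> Ex i; apply: (splitting_step theta_split (Ex i)). Qed.

Lemma encode_homeomorphism :
  homeomorphism [set x : config G | walk E x]
    [set y : config (A * B)%type | orbit_walk pi y] (encode theta).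
Proof.
exists (decode eta); split.
- by move=> x Ex; split; [apply: encode_orbit | apply: decodeK].
- by move=> y /encodeK.
- exact/continuous_subspaceT/encode_continuous.
- exact/continuous_subspaceT/decode_continuous.
Qed.

(** The pointwise operation of the walks, read through the code. *)
Definition transported (phi : G -> G -> G) (y z : config (A * B)%type) :=
  encode theta (fun i => phi (decode eta y i) (decode eta z i)).

(** Pointwise division of walks stays within the walks by
    [compatible_division], which makes the translations surjective. *)
Lemma transported_translation (phi : G -> G -> G) y :
  bipermutative phi ->
  (forall a b c d, E a b -> E c d -> E (phi a c) (phi b d)) ->
  orbit_walk pi y ->
  set_bij [set z : config (A * B)%type | orbit_walk pi z]
    [set z : config (A * B)%type | orbit_walk pi z] (transported phi y).
Proof.
move=> phi_biperm E_mul /encodeK[Ey _]; set a := decode eta y in Ey *.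
have Emul x : walk E x -> walk E (fun i => phi (a i) (x i)).
  by move=> Ex i; apply: E_mul.
split=> [z /encodeK[Ez _]|z w /set_mem/encodeK[Ez zK] /set_mem/encodeK[Ew wK]|
  z /encodeK[Ez zK]].
- exact/encode_orbit/Emul.
- move/(congr1 (decode eta)); rewrite !decodeK; try exact: Emul.
  move=> azw; rewrite -zK -wK; congr encode; apply/funext => i.
  apply: (left_translation_inj phi_biperm (a := a i)).
  exact: (congr1 (fun x => x i) azw).
- have /boolp.choice[u uP] i : exists u, phi (a i) u = decode eta z i.
    exact: right_divisible.
  have Eu : walk E u.
    move=> i; apply: (compatible_division phi_biperm E_mul (Ey i)).
    by rewrite !uP.
  exists (encode theta u); first exact: encode_orbit.
  rewrite /transported decodeK // -[RHS]zK; congr encode.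
  exact/funext.
Qed.

Lemma transported_conjugacy (phi : G -> G -> G) x : walk E x ->
  encode theta (ca_map phi x) =
  transported phi (encode theta x) (shift_map (encode theta x)).
Proof.
move=> Ex; have Esx : walk E (shift_map x) by move=> i; apply: Ex.
by rewrite /transported -[shift_map _]/(encode theta (shift_map x)) !decodeK.
Qed.

Lemma transported_block (phi : G -> G -> G) (H : set (config (A * B)%type)) :
  block_operation r.+1 H (transported phi).
Proof.
exists 0%N, r; split=> //.
exists (fun t : (0 + r).+1.-tuple ((A * B) * (A * B))%type =>
  theta (phi (eta [tuple (tnth t i).1 | i < r.+1])
             (eta [tuple (tnth t i).2 | i < r.+1]))) => z _ j.
by congr (theta (phi (eta _) (eta _))); apply: eq_mktuple => i;
  rewrite tnth_mktuple subr0.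
Qed.

Lemma encode_block (X : set (config G)) : block_code 1 X (encode theta).
Proof.
exists 0%N, 0%N; split=> //; exists (fun t => theta (tnth t ord0)) => x _ j.
by rewrite tnth_mktuple subr0 addr0.
Qed.
End Decoding.

Lemma bipermutative_flip (G : finType) (phi : G -> G -> G) :
  bipermutative phi -> bipermutative (fun a b => phi b a).
Proof. by case. Qed.

Lemma trivial_full_shift (n : nat) : (0 < n)%N ->
  (exists a : 'I_n, full_shift 'I_n = [set constant_config a]) <-> n = 1%N.
Proof.
case: n => // n _; split=> [[a full_a]|[n0]]; last first.
  subst n; exists ord0; apply/seteqP; split=> x // _; apply/funext => i.
  by rewrite [LHS]ord1.
have eq_a (b : 'I_n.+1) : b = a.
  have : full_shift 'I_n.+1 (constant_config b) by [].
  by rewrite full_a => /(congr1 (fun x => x 0)).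
by have := eq_a ord_max; rewrite -(eq_a ord0) => /(congr1 val) /= ->.
Qed.

Theorem proposition3p3 (R : realType) (G : finType) (X : set (config G))
    (phi : G -> G -> G)
    (X_tmc : topological_Markov_chain X)
    (X_letters : uses_all_letters X)
    (X_ca : cellular_automaton X phi)
    (phi_compat : structurally_compatible X phi)
    (phi_biperm : bipermutative phi) :
  exists (A : finType) (F : set (config A)) (n : nat) (k : nat)
         (op : config (A * 'I_n)%type -> config (A * 'I_n)%type ->
               config (A * 'I_n)%type),
    let H := prod_shift F (full_shift 'I_n) in
    (subshift F /\ finite_set F) /\ (1 <= n)%N /\ (1 <= k)%N /\
    quasigroup_operation H op /\ block_operation k H op /\
    conjugate_through_block_code 1 X (ca_map phi) H (fun x => op x (shift_map x)) /\
    (topological_entropy R X (@shift_map G) = 0%:E <->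
       exists a : 'I_n, full_shift 'I_n = [set constant_config a]) /\
    (irreducible_shift X /\ (exists g : G, X (constant_config g)) <->
       exists p : config A, F = [set p]).
Proof.
have X_shift := X_tmc.1.
have XE := Markov_chain_walks X_tmc X_letters.
have E_mul := successor_mul X_shift phi_compat.
have E_succ a : exists b, successor X a b.
  have [x Xx xa] := letter_at a 0 X_shift X_letters.
  by exists (x 1); apply/successorP => //; exists x.
have E_pred b : exists a, successor X a b.
  have [x Xx xb] := letter_at b 1 X_shift X_letters.
  by exists (x 0); apply/successorP => //; exists x.
have [A [n [pi [theta [r split]]]]] :=
  markov_splitting_ordinal phi_biperm E_mul E_succ E_pred.
have [eta [decodeK encodeK]] := exists_decode split.
have n_gt0 : (0 < n)%N by have := splitting_inhabited split; rewrite card_ord.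
have E_n a : #|successor X a| = n by rewrite (splitting_degree split) card_ord.
have pi_bij := splitting_bij split.
exists A, (orbits pi), n, r.+1, (transported theta eta phi) => H.
have HE : H = [set y : config (A * 'I_n)%type | orbit_walk pi y].
  by apply/seteqP; split=> [y [Hy _]|y Hy].
have X_shift_map x : X x -> X (shift_map x).
  by move=> Xx; rewrite -X_shift.2; exists x.
have conj : conjugate_through_block_code 1 X (ca_map phi) H
    (fun x => transported theta eta phi x (shift_map x)).
  exists (encode theta); split; last 2 first.
  - exact: encode_block.
  - by rewrite XE => x Ex; apply: (transported_conjugacy decodeK phi Ex).
  by rewrite HE XE; apply: (encode_homeomorphism split decodeK encodeK).
have entropy : topological_entropy R X (@shift_map G) = 0%:E <-> n = 1%N.
  split=> [entropy0|n1].
    have [//|[g0 _]] := splitting_trivial split; first by rewrite card_ord.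
    apply/eqP; rewrite eqn_leq n_gt0 andbT leqNgt; apply/negP => n_gt1.
    apply: (entropy_positive X_tmc X_letters E_n _ n_gt1 entropy0).
    by apply/card_gt0P; exists g0.
  apply: entropy_finite X_shift_map.
  apply: (@sub_finite_set _ _ (decode eta @` H)).
    rewrite XE => x Ex; exists (encode theta x); last exact: decodeK.
    by rewrite HE; apply: (encode_orbit split Ex).
  apply/finite_image/finite_of_letter0 => y z [Fy _] [Fz _] yz0.
  have yz := orbits_determined pi_bij Fy Fz (congr1 fst yz0).
  apply/funext => i; rewrite [LHS]surjective_pairing [RHS]surjective_pairing.
  congr pair; first exact: (congr1 (fun x => x i) yz).
  by move: (y i).2 (z i).2; rewrite n1 => a b; rewrite !ord1.
split; first by split; [apply: orbits_subshift | apply: orbits_finite].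
split=> //; split=> //; split.
  move=> y; rewrite HE => y_orbit; split.
    exact: (transported_translation split decodeK encodeK phi_biperm E_mul y_orbit).
  apply: (transported_translation split decodeK encodeK
    (bipermutative_flip phi_biperm) _ y_orbit) => a b c d Eab Ecd.
  exact: E_mul.
split; first exact: transported_block.
split=> //; split.
  by rewrite entropy trivial_full_shift.
exact: (irreducible_constant_orbits split X_shift X_letters XE).
Qed.
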